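(* Suppose that all line impedances have the same argument $\theta$, i.e. $z_e=e^{j\theta}|z_e|$ for all edges $e$. Let $C_r\subseteq C$ be a nonempty cluster, and define $K_r(u_C)\in\mathbb{R}^m$ (indexed by $C$) by $$[K_r(u_C)]_k:=\begin{cases}\dfrac{1}{|C_r|}\displaystyle\sum_{v\in C_r}|u_v||u_k|\sin(\angle u_v-\angle u_k+\theta)&\text{if }k\in C_r,\\[2mm]0&\text{if }k\notin C_r.\end{cases}$$ Then the elements $[\nabla J]_k$, $k\in C_r$, of the gradient $\nabla J=Mq_C+Nq_{V\setminus C}$ can be decomposed as $$[\nabla J]_k=\cos\theta\,[K_r(u_C)]_k+\alpha_r+\frac{1}{U_N}\left[\tilde K_r(u_C)\right]_k,$$ where $[\tilde K_r(u_C)]_k$ is bounded as $U_N\to\infty$, and $\alpha_r$ is a quantity independent of the index $k$ (it may depend on $r$ and $U_N$).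
   Context: $j$ is the imaginary unit; bar is complex conjugation; $\angle y$ is the argument of $y$. Let $G$ be a finite directed graph with node set $V$, $|V|=n$, a distinguished node $0$, and edge set $E$ (each edge $e$ going from $\sigma(e)$ to $\tau(e)$), connected irrespective of edge orientation. $A\in\{0,\pm1\}^{|E|\times n}$ is the incidence matrix: $[A]_{ev}=-1$ if $v=\sigma(e)$, $1$ if $v=\tau(e)$, $0$ otherwise. Each edge $e$ has an impedance $z_e\in\mathbb{C}$ with $\mathrm{Re}(z_e)>0$; $Z=\mathrm{diag}(z_e)$, $L=A^TZ^{-1}A$, and $X\in\mathbb{C}^{n\times n}$ is the unique symmetric matrix with $XL=I-\mathbf{1}\mathbf{1}_0^T$, $X\mathbf{1}_0=0$. Nominal complex powers $s_v$, $v\in V\setminus\{0\}$, are fixed, and $s_0:=-\sum_{v\ne0}s_v$; $q:=\mathrm{Im}(s)\in\mathbb{R}^n$. $C\subseteq V$ is the set of compensators, $m=|C|$. Ordering the nodes of $C$ first, $q=(q_C,q_{V\setminus C})$ and $\mathrm{Re}(X)=\begin{bmatrix}M&N\\N^T&Q\end{bmatrix}$ with $M\in\mathbb{R}^{m\times m}$; $\nabla J$ is the gradient of $J(q)=\frac12q^T\mathrm{Re}(X)q$ with respect to $q_C$. The voltages $u=u(U_N)\in\mathbb{C}^n$, functions of the nominal voltage $U_N$, together with currents $i=i(U_N)$, solve $u=Xi+U_Ne^{j\phi}\mathbf{1}$, $\mathbf{1}^Ti=0$, $u_v\bar i_v=s_v|u_v/U_N|^{\eta_v}$ for $v\ne0$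 (with $\phi,\eta_v$ fixed reals), and are the solutions admitting, for large $U_N$, the expansion $u_v=e^{j\phi}\left(U_N+\frac{[X\bar s]_v}{U_N}+\frac{d_v(U_N)}{U_N^2}\right)$ with $d_v(U_N)$ bounded as $U_N\to\infty$. $u_C$ is the vector of the components $u_k$, $k\in C$. *)

(* Defs.v *)
From HB Require Import structures.
From mathcomp Require Export all_boot all_order all_algebra.
From mathcomp Require Export complex.
From mathcomp Require Export all_classical all_reals all_analysis.
Export Order.TTheory GRing.Theory Num.Theory.
Export numFieldNormedType.Exports.
Export ComplexField.Normc.

Set Implicit Arguments.
Unset Strict Implicit.
Unset Printing Implicit Defensive.

Local Open Scope classical_set_scope.
Local Open Scope ring_scope.
Local Open Scope complex_scope.

Definition expj (R : realType) (t : R) : R[i] := cos t +i* sin t.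

(* Principal argument, in ]-pi, pi]; the value at 0 is the junk acos 0. *)
Definition carg (R : realType) (y : R[i]) : R :=
  if 0 <= complex.Im y then acos (complex.Re y / normc y)
  else - acos (complex.Re y / normc y).

(* The network has nodes 'I_n and edges 'I_p; edge e goes from sigma e to
   tau e. *)

Definition adjacent (n p : nat) (sigma tau : 'I_p -> 'I_n) : rel 'I_n :=
  fun v w => [exists e, ((sigma e == v) && (tau e == w)) ||
                        ((sigma e == w) && (tau e == v))].

Definition connected_graph (n p : nat) (sigma tau : 'I_p -> 'I_n) : Prop :=
  forall v w : 'I_n, connect (adjacent sigma tau) v w.

(* A self-loop, for which the two nonzero cases overlap, gets the entry -1. *)
Definition incidence (R : realType) (n p : nat) (sigma tau : 'I_p -> 'I_n) :
    'M[R[i]]_(p, n) :=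
  \matrix_(e, v) (if v == sigma e then -1 else if v == tau e then 1 else 0).

Definition impedance_mx (R : realType) (p : nat) (z : 'I_p -> R[i]) :
    'M[R[i]]_p :=
  diag_mx (\row_e z e).

Definition weighted_laplacian (R : realType) (n p : nat)
    (sigma tau : 'I_p -> 'I_n) (z : 'I_p -> R[i]) : 'M[R[i]]_n :=
  let A := incidence R sigma tau in
  A^T *m invmx (impedance_mx z) *m A.

Definition is_green_mx (R : realType) (n : nat) (v0 : 'I_n)
    (L X : 'M[R[i]]_n) : Prop :=
  let one0 : 'cV[R[i]]_n := delta_mx v0 0 in
  [/\ X^T = X,
      X *m L = 1%:M - (const_mx 1 : 'cV_n) *m one0^T &
      X *m one0 = 0].

Definition power_flow (R : realType) (n : nat) (v0 : 'I_n) (X : 'M[R[i]]_n)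
    (s : 'cV[R[i]]_n) (phi : R) (eta : 'I_n -> R) (UN : R)
    (u i : 'cV[R[i]]_n) : Prop :=
  [/\ u = X *m i + (UN%:C * expj phi) *: const_mx 1,
      \sum_v i v 0 = 0 &
      forall v, v != v0 ->
        u v 0 * conjc (i v 0) = s v 0 * (normc (u v 0 / UN%:C) `^ eta v)%:C].

(* Vectors and matrices indexed by a set C of nodes are indexed by 'I_#|C|
   through enum_val: the k-th coordinate is the one of the node enum_val k. *)

Definition node (n : nat) (C : {set 'I_n}) (k : 'I_#|C|) : 'I_n := enum_val k.

Definition restr_col (T : Type) (n : nat) (C : {set 'I_n}) (x : 'cV[T]_n) :
    'cV[T]_#|C| :=
  rowsub (@node n C) x.

Definition restr_block (T : Type) (n : nat) (C D : {set 'I_n}) (B : 'M[T]_n) :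
    'M[T]_(#|C|, #|D|) :=
  mxsub (@node n C) (@node n D) B.

Definition re_mx (R : realType) (m n : nat) (B : 'M[R[i]]_(m, n)) :
    'M[R]_(m, n) :=
  map_mx (@complex.Re R) B.

Definition im_mx (R : realType) (m n : nat) (B : 'M[R[i]]_(m, n)) :
    'M[R]_(m, n) :=
  map_mx (@complex.Im R) B.

Definition J_cost (R : realType) (n : nat) (X : 'M[R[i]]_n) (q : 'cV[R]_n) :
    R :=
  2^-1 * (q^T *m re_mx X *m q) 0 0.

(* Gradient with respect to q_C only: the partial derivatives of J along the
   coordinates in C, the other coordinates of q being held fixed. *)
Definition grad_J (R : realType) (n : nat) (X : 'M[R[i]]_n) (C : {set 'I_n})
    (q : 'cV[R]_n) : 'cV[R]_#|C| :=
  \col_k 'D_(delta_mx (node k) 0 : 'cV[R]_n) (J_cost X) q.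

Definition K_cluster (R : realType) (n : nat) (C Cr : {set 'I_n}) (theta : R)
    (uC : 'cV[R[i]]_#|C|) : 'cV[R]_#|C| :=
  \col_k (if node k \in Cr then
            #|Cr|%:R^-1 *
            \sum_(l : 'I_#|C| | node l \in Cr)
              normc (uC l 0) * normc (uC k 0) *
              sin (carg (uC l 0) - carg (uC k 0) + theta)
          else 0).

(* Main.v *)
(* With a common argument theta, conj L = e^{2 j theta} L, so by uniqueness of
   the Green matrix X = e^{2 j theta} conj X; hence
   cos theta e^{j theta} conj X = Re X.  By polar decomposition the summands of
   K_r are Im (e^{j theta} u_v conj u_k).  Inserting the expansion of u, with
   w = X conj s, and dropping O(1/U) terms, this is
   Im (e^{j theta} (U^2 + w_v)) + Im (e^{j theta} conj w_k): averaging over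
   v, the first part does not depend on k and gives alpha_r = - cos theta times
   it, while cos theta times the second one is (Re X q)_k = [grad J]_k. *)
Require Import Defs.
From mathcomp Require Import ring.

Set Implicit Arguments.
Unset Strict Implicit.
Unset Printing Implicit Defensive.

Local Open Scope classical_set_scope.
Local Open Scope ring_scope.
Local Open Scope complex_scope.

(** * Polar form and modulus of complex numbers *)

Lemma normc_cos_sin_carg (R : realType) (y : R[i]) :
  normc y * cos (carg y) = complex.Re y /\ normc y * sin (carg y) = complex.Im y.
Proof.
case: (eqVneq y 0) => [->|y0].
  (* The zero modulus absorbs the junk value of [carg] at 0. *)
  by rewrite normc0 !mul0r.
have ny0 : normc y != 0 by apply: contra_neq y0 => /eq0_normc.
case: y y0 ny0 => a b y0; rewrite /carg /normc /=.
set r := Num.sqrt _ => r0.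
have rE : r ^+ 2 = a ^+ 2 + b ^+ 2 by rewrite sqr_sqrtr // addr_ge0 ?sqr_ge0.
have rgt0 : 0 < r by rewrite lt_def r0 sqrtr_ge0.
have ar : -1 <= a / r <= 1.
  rewrite ler_pdivlMr // ler_pdivrMr // mulN1r mul1r -ler_norml.
  rewrite -(@ler_pXn2r _ 2%N) ?nnegrE ?(ltW rgt0) // real_normK ?num_real // rE.
  by rewrite lerDl sqr_ge0.
(* The sine of [acos x] is the nonnegative root of 1 - x^2, so it recovers b only up to sign; the
   two branches of [carg] restore the sign. *)
have br : Num.sqrt (1 - (a / r) ^+ 2) = `|b| / r.
  have -> : 1 - (a / r) ^+ 2 = (b / r) ^+ 2.
    have bE : b ^+ 2 = r ^+ 2 - a ^+ 2 by rewrite rE addrC addKr.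
    by rewrite !expr_div_n bE; field.
  by rewrite sqrtr_sqr normrM normfV (gtr0_norm rgt0).
case: ifP => b0; rewrite ?cosN ?sinN acosK ?in_itv ?sin_acos //= br.
  by rewrite (ger0_norm b0) !(mulrC r) !divfK.
rewrite ltr0_norm; last by rewrite ltNge b0.
by rewrite mulNr opprK !(mulrC r) !divfK.
Qed.

(** Arguments enter only through their sine and cosine, so the addition formulas suffice and no
    reduction modulo 2 pi arises. *)
Lemma normc_mul_sin_carg (R : realType) (theta : R) (y w : R[i]) :
  normc y * normc w * sin (carg y - carg w + theta) =
  complex.Im (expj theta * (y * conjc w)).
Proof.
have polar (x : R[i]) : x = (normc x * cos (carg x)) +i* (normc x * sin (carg x)).
  by have [-> ->] := normc_cos_sin_carg x; case: x.
rewrite sinD sinB cosB [in RHS](polar y) [in RHS](polar w) /expj.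
rewrite [RHS]/=; ring.
Qed.

Lemma normc_ge0 (R : realType) (y : R[i]) : 0 <= normc y.
Proof. by case: y => a b; rewrite /normc sqrtr_ge0. Qed.

Lemma normc_expj (R : realType) (t : R) : normc (expj t) = 1.
Proof. by rewrite /normc /= cos2Dsin2 sqrtr1. Qed.

Lemma mul_conjc_expj (R : realType) (t : R) : expj t * conjc (expj t) = 1.
Proof.
apply/eqP; rewrite eq_complex /=; apply/andP; split; apply/eqP; last ring.
by rewrite mulrN opprK -!expr2 cos2Dsin2.
Qed.

Lemma conjcM (R : realType) (x y : R[i]) :
  conjc (x * y) = conjc x * conjc y.
Proof. exact: (rmorphM (@conjc R)). Qed.

Lemma normc_conj (R : realType) (y : R[i]) : normc (conjc y) = normc y.
Proof. by case: y => a b; rewrite /normc /= sqrrN. Qed.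

Lemma normc_real (R : realType) (x : R) : normc x%:C = `|x|.
Proof. by rewrite /normc /= expr0n addr0 sqrtr_sqr. Qed.

Lemma ler_norm_Im (R : realType) (y : R[i]) : `|complex.Im y| <= normc y.
Proof.
case: y => a b; rewrite /normc /= -sqrtr_sqr ler_wsqrtr // lerDr.
exact: sqr_ge0.
Qed.

(** * Effect of conjugation on the Laplacian and its Green matrix *)

Lemma conjc_incidence (R : realType) (n p : nat) (sigma tau : 'I_p -> 'I_n) :
  map_mx conjc (incidence R sigma tau) = incidence R sigma tau.
Proof.
apply/matrixP => e v; rewrite !mxE.
by case: ifP => _; [rewrite rmorphN1 | case: ifP => _; rewrite ?rmorph1 ?rmorph0].
Qed.

Lemma tr_weighted_laplacian (R : realType) (n p : nat)
    (sigma tau : 'I_p -> 'I_n) (z : 'I_p -> R[i]) :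
  (weighted_laplacian sigma tau z)^T = weighted_laplacian sigma tau z.
Proof.
by rewrite /weighted_laplacian !trmx_mul trmxK trmx_inv tr_diag_mx mulmxA.
Qed.

(** Conjugation multiplies each z_e by e^{-2 j theta}, hence Z^{-1} by e^{2 j theta}, while the
    incidence matrix is real. *)
Lemma conjc_weighted_laplacian (R : realType) (n p : nat)
    (sigma tau : 'I_p -> 'I_n) (z : 'I_p -> R[i]) (theta : R) :
  (forall e, z e != 0) ->
  (forall e, z e = expj theta * (normc (z e))%:C) ->
  map_mx conjc (weighted_laplacian sigma tau z) =
  expj theta ^+ 2 *: weighted_laplacian sigma tau z.
Proof.
move=> z0 zE; rewrite /weighted_laplacian.
have Zc : map_mx conjc (impedance_mx z) =
    (expj theta ^+ 2)^-1 *: impedance_mx z.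
  rewrite /impedance_mx map_diag_mx -linearZ; congr diag_mx.
  apply/rowP => e; rewrite !mxE [in LHS]zE [in RHS]zE [LHS]conjcM conjc_real.
  have u0 : expj theta != 0.
    by apply/eqP => /(congr1 (@normc R)) /eqP; rewrite normc_expj normc0 oner_eq0.
  have -> : conjc (expj theta) = (expj theta)^-1.
    by apply: (mulfI u0); rewrite mul_conjc_expj mulfV.
  by field.
have Zu : map_mx conjc (impedance_mx z) \in unitmx.
  rewrite map_unitmx unitmxE det_diag unitfE; apply/prodf_neq0 => e _.
  by rewrite mxE.
rewrite !map_mxM -map_trmx conjc_incidence map_invmx Zc.
rewrite invmxZ -?Zc // invrK.
by rewrite -scalemxAr -scalemxAl.
Qed.

(* Transposing X L = I - 1 1_0^T gives L X = I - 1_0 1^T, and Y - X annihilates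
   both L and 1_0; so uniqueness needs no connectedness of the graph. *)
Lemma green_mx_unique (R : realType) (n : nat) (v0 : 'I_n)
    (L X Y : 'M[R[i]]_n) :
  L^T = L -> is_green_mx v0 L X ->
  Y *m L = 1%:M - (const_mx 1 : 'cV_n) *m (delta_mx v0 0 : 'cV_n)^T ->
  Y *m (delta_mx v0 0 : 'cV_n) = 0 -> Y = X.
Proof.
move=> Ls [Xs XL X0] YL Y0.
have LX : L *m X = 1%:M - (delta_mx v0 0 : 'cV_n) *m (const_mx 1 : 'cV_n)^T.
  by rewrite -[L]Ls -[X]Xs -trmx_mul XL linearB /= trmx1 trmx_mul trmxK.
have : (Y - X) *m (L *m X) = 0 by rewrite mulmxA mulmxBl YL XL subrr mul0mx.
rewrite LX mulmxBr mulmx1 mulmxA mulmxBl Y0 X0 subr0 mul0mx subr0.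
by move/eqP; rewrite subr_eq0 => /eqP.
Qed.

(** In the conjugate of X L = I - 1 1_0^T the right-hand side is unchanged, and the factor e^{2 j
    theta} of conj L can be moved onto conj X; uniqueness concludes. *)
Lemma conjc_green_mx (R : realType) (n p : nat) (v0 : 'I_n)
    (sigma tau : 'I_p -> 'I_n) (z : 'I_p -> R[i]) (X : 'M[R[i]]_n)
    (theta : R) :
  (forall e, z e != 0) ->
  (forall e, z e = expj theta * (normc (z e))%:C) ->
  is_green_mx v0 (weighted_laplacian sigma tau z) X ->
  expj theta ^+ 2 *: map_mx conjc X = X.
Proof.
move=> z0 zE gX; have [_ XL X0] := gX.
have d0 : map_mx conjc (delta_mx v0 0 : 'cV[R[i]]_n) = delta_mx v0 0.
  by rewrite map_delta_mx.
apply: (green_mx_unique (tr_weighted_laplacian sigma tau z) gX).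
  rewrite -scalemxAl scalemxAr -conjc_weighted_laplacian // -map_mxM XL.
  rewrite map_mxB map_mx1 map_mxM -map_trmx d0 map_const_mx.
  by rewrite (rmorph1 (@conjc R)).
by rewrite -scalemxAl -d0 -map_mxM X0 map_mx0 scaler0.
Qed.

(** * The gradient of J, first as Re X q, then through X conj s *)

Lemma grad_JE (R : realType) (n : nat) (X : 'M[R[i]]_n) (C : {set 'I_n})
    (q : 'cV[R]_n) :
  X^T = X -> grad_J X C q = restr_col C (re_mx X *m q).
Proof.
move=> Xs; apply/colP => k; rewrite !mxE -[LHS]/(lim _).
set B := re_mx X; set v : 'cV[R]_n := delta_mx (node k) 0.
have Bs : B^T = B by rewrite /B /re_mx map_trmx Xs.
have vB : v^T *m B *m q = row (node k) (B *m q).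
  by rewrite -mulmxA trmx_delta -rowE.
(* A 1 x 1 matrix equals its transpose, and B is symmetric. *)
have qB : q^T *m B *m v = v^T *m B *m q.
  have tr11 (a : 'M[R]_1) : a^T = a by apply/matrixP => i j; rewrite mxE !ord1.
  by rewrite -[LHS]tr11 !trmx_mul trmxK Bs mulmxA.
rewrite (_ : \sum_j _ = (v^T *m B *m q) 0 0); last by rewrite vB !mxE.
apply: cvg_lim => //.
pose c := (v^T *m B *m v) 0 0.
(* J is quadratic, so its increment is exact: the two equal cross terms cancel the factor 1/2, and
   only a term of order h^2 remains. *)
have JE h : J_cost X (h *: v + q) - J_cost X q =
    h * ((v^T *m B *m q) 0 0 + h * (2^-1 * c)).
  have vqT : (h *: v + q)^T = h *: v^T + q^T.
    by apply/rowP => l; rewrite !mxE.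
  rewrite /J_cost -/B vqT !(mulmxDl, mulmxDr) -!scalemxAl.
  rewrite -!scalemxAr qB /c.
  move: (v^T *m B *m q) (v^T *m B *m v) (q^T *m B *m q) => a b e.
  by rewrite !mxE; field.
have cv : (v^T *m B *m q) 0 0 + h * (2^-1 * c) @[h --> (0 : R)^'] -->
    (v^T *m B *m q) 0 0.
  rewrite -[X in _ --> X]addr0 -[X in _ --> _ + X](mul0r (2^-1 * c)).
  apply: cvgD; first exact: cvg_cst.
  apply: cvgM; last exact: cvg_cst.
  exact: nbhs_dnbhs.
(* Dividing the increment by h requires h != 0, which the punctured neighbourhood provides. *)
apply: cvg_trans cv; apply: near_eq_cvg; near=> h.
rewrite /= JE -[RHS]/(h^-1 * _) mulKf //.
by near: h; exact: nbhs_dnbhs_neq.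
Unshelve. all: by end_near.
Qed.

Lemma restr_col_mulmx (T : pzSemiRingType) (n : nat) (C : {set 'I_n})
    (B : 'M[T]_n) (q : 'cV[T]_n) :
  restr_col C (B *m q) = restr_block C C B *m restr_col C q
    + restr_block C (~: C)%SET B *m restr_col (~: C)%SET q.
Proof.
apply/colP => k; rewrite !mxE (bigID (mem C)) /=; congr (_ + _).
  by rewrite big_enum_val; apply: eq_bigr => l _; rewrite !mxE.
rewrite (eq_bigl (fun l => l \in (~: C)%SET));
  last by move=> l; rewrite [RHS]finset.in_setC.
by rewrite big_enum_val; apply: eq_bigr => l _; rewrite !mxE.
Qed.

Lemma sum_node (V : nmodType) (n : nat) (C D : {set 'I_n}) (F : 'I_n -> V) :
  D \subset C ->
  \sum_(l : 'I_#|C| | node l \in D) F (node l) = \sum_(v in D) F v.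
Proof.
move=> /fintype.subsetP DC; rewrite big_mkcond.
rewrite -(big_enum_val (fun v => if v \in D then F v else 0)).
rewrite -big_mkcondr; apply: eq_bigl => v.
by rewrite andbC; case: (boolP (v \in D)) => //= /DC ->.
Qed.

(* The hypothesis on x says that x = r e^{j theta} with r real. *)
Lemma Re_mul_Im (R : realType) (theta : R) (x y : R[i]) :
  expj theta ^+ 2 * conjc x = x ->
  complex.Re x * complex.Im y =
  cos theta * complex.Im (expj theta * (conjc x * y)).
Proof.
move=> xE; pose r := expj theta * conjc x.
have xr : x = expj theta * r by rewrite mulrA -expr2 xE.
(* Conjugating r gives conj (e^{j theta}) x, and x = e^{j theta} r brings this back to r. *)
have rr : conjc r = r.
  by rewrite conjcM conjcK {1}xr mulrA (mulrC (conjc _)) mul_conjc_expj mul1r.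
rewrite mulrA -/r xr; case: (r) rr y => a b [] /eqP.
rewrite eq_sym -subr_eq0 opprK -mulr2n mulrn_eq0 /= => /eqP -> [c e] /=; ring.
Qed.

Lemma restr_green_power (R : realType) (n : nat) (X : 'M[R[i]]_n)
    (s : 'cV[R[i]]_n) (theta : R) (k : 'I_n) :
  expj theta ^+ 2 *: map_mx conjc X = X ->
  (re_mx X *m im_mx s) k 0 =
  cos theta * complex.Im (expj theta * conjc ((X *m map_mx conjc s) k 0)).
Proof.
move=> XE.
have -> : conjc ((X *m map_mx conjc s) k 0) = \sum_v conjc (X k v) * s v 0.
  rewrite mxE (rmorph_sum (@conjc R)); apply: eq_bigr => v _.
  by rewrite [LHS]conjcM mxE conjcK.
rewrite mulr_sumr mxE.
rewrite (raddf_sum (@complex.Im R : Rcomplex R -> R)) mulr_sumr.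
apply: eq_bigr => v _; rewrite !mxE; apply: Re_mul_Im.
by move/matrixP/(_ k v): XE; rewrite !mxE.
Qed.

(** * Expansion of the products of voltages and of K_r *)

Definition voltage_remainder (R : realType) (U : R) (w d w' d' : R[i]) : R[i] :=
  d + conjc d' + (w + d / U%:C) * conjc (w' + d' / U%:C) / U%:C.

(** The common phase phi cancels because e^{j phi} has modulus 1. [voltage_remainder] is U times all
    that the product contains beyond U^2 + w + conj w'. *)
Lemma voltage_product (R : realType) (phi U : R) (w d w' d' : R[i]) :
  U != 0 ->
  expj phi * (U%:C + w / U%:C + d / U%:C ^+ 2) *
    conjc (expj phi * (U%:C + w' / U%:C + d' / U%:C ^+ 2)) =
  U%:C ^+ 2 + w + conjc w' + voltage_remainder U w d w' d' / U%:C.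
Proof.
move=> U0; have UC0 : U%:C != 0 by rewrite eq_complex /= negb_and U0.
rewrite conjcM mulrACA mul_conjc_expj mul1r /voltage_remainder.
have conjD (x y : R[i]) : conjc (x + y) = conjc x + conjc y.
  exact: (rmorphD (@conjc R)).
have conj_div (x : R[i]) (t : R) : conjc (x / t%:C) = conjc x / t%:C.
  by rewrite conjcM conjc_inv conjc_real.
have U2 : U%:C ^+ 2 = (U ^+ 2)%:C by rewrite rmorphXn.
rewrite !conjD U2 !conj_div conjc_real -U2.
by field.
Qed.

(** For U >= 1 a division by U does not increase the modulus, so each factor of the product term is
    at most M + M. *)
Lemma le_normc_remainder (R : realType) (U M : R) (w d w' d' : R[i]) :
  1 <= U -> normc w <= M -> normc d <= M -> normc w' <= M -> normc d' <= M ->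
  normc (voltage_remainder U w d w' d') <= M + M + (M + M) ^+ 2.
Proof.
move=> U1 wM dM wM' dM'.
have U0 : 0 < U by apply: lt_le_trans U1.
have U1' (x : R[i]) : normc (x / U%:C) <= normc x.
  rewrite normcM normcV normc_real (gtr0_norm U0) ler_pdivrMr //.
  by rewrite ler_peMr // normc_ge0.
have triangle (x y : R[i]) (a b : R) :
    normc x <= a -> normc y <= b -> normc (x + y) <= a + b.
  by move=> xa yb; apply: le_trans (lerD xa yb); exact: le_normcD.
rewrite /voltage_remainder; apply: (triangle).
  by apply: (triangle); rewrite ?normc_conj.
apply: le_trans (U1' _) _; rewrite normcM normc_conj expr2.
by apply: ler_pM; rewrite ?normc_ge0 //; apply: (triangle) => //;
  exact: le_trans (U1' _) _.
Qed.

Lemma near_uniform_bound (R : realType) (n : nat) (d : R -> 'cV[R[i]]_n) :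
  (forall v, bounded_near (fun U : R => normc (d U v 0)) +oo) ->
  exists M, \forall U \near +oo, forall v, normc (d U v 0) <= M.
Proof.
move=> hd.
have /choice [m mP] v : exists M, \forall U \near +oo, normc (d U v 0) <= M.
  have /ex_bound [M hM] := hd v; exists M.
  by apply: filterS hM => U /=; apply: le_trans; exact: ler_norm.
(* This sum dominates every [m v], and finitely many eventual bounds hold simultaneously. *)
exists (\sum_v `|m v|).
have := @filter_forall _ _ (fun v U => is_true (normc (d U v 0) <= m v)) _
  proper_pinfty_nbhs mP.
apply: filterS => U dU v; apply: (le_trans (dU v)).
by rewrite (bigD1 v) //= ler_wpDr ?sumr_ge0 // ler_norm.
Qed.

(** The three terms are sorted by role: one depends on k alone, one is an average free of k, and one
    is of order 1/U. *)
Lemma K_cluster_expansion (R : realType) (n : nat) (C Cr : {set 'I_n})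
    (theta phi U : R) (u w d : 'cV[R[i]]_n) (k : 'I_#|C|) :
  U != 0 ->
  (forall v, u v 0 = expj phi * (U%:C + w v 0 / U%:C + d v 0 / U%:C ^+ 2)) ->
  Cr \subset C -> Cr != finset.set0 -> node k \in Cr ->
  K_cluster Cr theta (restr_col C u) k 0 =
  complex.Im (expj theta * conjc (w (node k) 0))
  + #|Cr|%:R^-1 *
      \sum_(v in Cr) complex.Im (expj theta * (U%:C ^+ 2 + w v 0))
  + U^-1 * (#|Cr|%:R^-1 *
      \sum_(v in Cr) complex.Im (expj theta *
        voltage_remainder U (w v 0) (d v 0) (w (node k) 0) (d (node k) 0))).
Proof.
move=> U0 uE CrC Cr0 kCr; rewrite !mxE kCr.
have cr0 : #|Cr|%:R != 0 :> R by rewrite pnatr_eq0 cards_eq0.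
under eq_bigr => l _ do rewrite normc_mul_sin_carg !mxE.
rewrite (sum_node (fun v =>
  complex.Im (expj theta * (u v 0 * conjc (u (node k) 0))))) //.
set W := complex.Im (expj theta * conjc _).
(* A constant is its own average over the nonempty cluster, so all terms become averages and can be
   compared summand by summand. *)
have -> : W = #|Cr|%:R^-1 * \sum_(v in Cr) W.
  by rewrite sumr_const -[W *+ _]mulr_natl mulKf.
rewrite [U^-1 * _]mulrCA -!mulrDr [U^-1 * _]mulr_sumr -!big_split /=.
congr (_ * _).
apply: eq_bigr => v _; rewrite !uE voltage_product // /W.
have ImD (x y : R[i]) : complex.Im (x + y) = complex.Im x + complex.Im y.
  by case: x y => ? ? [].
have ImZ (x : R[i]) : complex.Im (x / U%:C) = U^-1 * complex.Im x.
  rewrite -(rmorphV (real_complex R)) ?unitfE //.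
  by case: x => a b; simpl; ring.
by rewrite !(mulrDr, mulrA, ImD) ImZ; ring.
Qed.

Theorem proposition4 (R : realType) (n p : nat) (v0 : 'I_n)
  (sigma tau : 'I_p -> 'I_n) (z : 'I_p -> R[i]) (X : 'M[R[i]]_n)
  (s : 'cV[R[i]]_n) (C Cr : {set 'I_n})
  (phi : R) (eta : 'I_n -> R) (theta : R)
  (u i d : R -> 'cV[R[i]]_n)
  (hconn : connected_graph sigma tau)
  (hz : forall e, 0 < complex.Re (z e))
  (hX : is_green_mx v0 (weighted_laplacian sigma tau z) X)
  (hs0 : s v0 0 = - \sum_(v | v != v0) s v 0)
  (hsol : \forall UN \near +oo, power_flow v0 X s phi eta UN (u UN) (i UN))
  (hexp : \forall UN \near +oo, forall v,
     u UN v 0 = expj phi * (UN%:C + (X *m map_mx conjc s) v 0 / UN%:C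
                            + d UN v 0 / UN%:C ^+ 2))
  (hd : forall v, bounded_near (fun UN : R => normc (d UN v 0)) +oo)
  (htheta : forall e, z e = expj theta * (normc (z e))%:C)
  (hCr : Cr \subset C) (hCr0 : Cr != finset.set0) :
  let q := im_mx s in
  let M := restr_block C C (re_mx X) in
  let N := restr_block C (~: C)%SET (re_mx X) in
  let gradJ := grad_J X C q in
  gradJ = M *m restr_col C q + N *m restr_col (~: C)%SET q /\
  exists (alpha : R -> R) (Kt : R -> 'cV[R]_#|C|),
    forall k : 'I_#|C|, node k \in Cr ->
      (forall UN : R, 0 < UN ->
         gradJ k 0 = cos theta * K_cluster Cr theta (restr_col C (u UN)) k 0
                     + alpha UN + UN^-1 * Kt UN k 0) /\
      bounded_near (fun UN : R => Kt UN k 0) +oo.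
Proof.
move=> q M N gradJ; have [Xs _ _] := hX.
have gE : gradJ = restr_col C (re_mx X *m q) by exact: grad_JE.
split; first by rewrite gE restr_col_mulmx.
have z0 e : z e != 0 by apply: contraTneq (hz e) => ->; rewrite ltxx.
have XE := conjc_green_mx z0 htheta hX.
pose w := X *m map_mx conjc s.
(* Chosen to cancel the k-free average in cos theta K_r. *)
pose alpha (U : R) := - (cos theta * (#|Cr|%:R^-1 *
  \sum_(v in Cr) complex.Im (expj theta * (U%:C ^+ 2 + w v 0)))).
pose K (U : R) := K_cluster Cr theta (restr_col C (u U)).
exists alpha, (fun U => \col_k (U * (gradJ k 0 - cos theta * K U k 0 - alpha U))).
move=> k kCr; split=> [U U0|].
  by rewrite [X in U^-1 * X]mxE mulKf ?gt_eqF // -/(K U); ring.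
have [D hD] := near_uniform_bound hd.
(* One bound for both d and w; the latter does not depend on U. *)
pose B := Num.max D (\sum_v normc (w v 0)).
apply/ex_bound; exists (B + B + (B + B) ^+ 2).
near=> U.
have U1 : 1 <= U by near: U; exact: nbhs_pinfty_ge.
have U0 : U != 0 by rewrite gt_eqF // (lt_le_trans ltr01).
have uE : forall v, u U v 0 =
    expj phi * (U%:C + w v 0 / U%:C + d U v 0 / U%:C ^+ 2) by near: U.
have dB v : normc (d U v 0) <= B.
  rewrite le_max; apply/orP; left; move: v; near: U; exact: hD.
have wB v : normc (w v 0) <= B.
  rewrite le_max; apply/orP; right.
  by rewrite (bigD1 v) //= lerDl sumr_ge0 // => ? _; exact: normc_ge0.
rewrite /= mxE gE mxE (restr_green_power _ _ XE) -/w.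
rewrite /K (K_cluster_expansion theta U0 uE hCr hCr0 kCr) /alpha.
set S := \sum_(v in Cr) complex.Im (expj theta * voltage_remainder _ _ _ _ _).
set A := complex.Im _; set T := \sum_(v in Cr) _.
have cr0 : 0 < #|Cr|%:R :> R by rewrite ltr0n card_gt0.
(* The gradient cancels the term depending on k alone and alpha cancels [T]; the factor U
   compensates the 1/U in front of the averaged remainders [S]. *)
rewrite (_ : U * _ = - (cos theta * (#|Cr|%:R^-1 * S))); last first.
  by field; rewrite U0 gt_eqF.
rewrite normrN normrM; apply: (le_trans (ler_piMl (normr_ge0 _) _)).
  by rewrite ler_norml cos_geN1 cos_le1.
rewrite normrM gtr0_norm ?invr_gt0 // ler_pdivrMl //.
apply: (le_trans (ler_norm_sum _ _ _)).
(* The bound times |C_r| is rewritten as a sum over C_r, to be compared termwise. *)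
rewrite mulr_natl -sumr_const; apply: ler_sum => v _.
apply: (le_trans (ler_norm_Im _)); rewrite normcM normc_expj mul1r.
exact: le_normc_remainder.
Unshelve. all: by end_near.
Qed.
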